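(* Let $n\ge1$, let $M$ be a path-connected topological space with an involution $\tau\colon M\to M$, and let $\sigma\colon S^n\to S^n$ be the antipodal involution $\sigma(z)=-z$. If $X(M,S^n)$ is completely normal, then $$\mathrm{cat}(X(M,S^n))\le\mathrm{cat}_{\langle\tau\rangle}^{\#}(M)+n .$$
   Context: For spaces $M,N$ with involutions $\tau$ on $M$ and $\sigma$ on $N$, $\sigma$ fixed-point free, $X(M,N)=(M\times N)/\bigl((x,y)\sim(\tau(x),\sigma(y))\bigr)$ (generalized projective product space). $\langle\tau\rangle$ is the group generated by $\tau$. $\mathrm{cat}(X)$ is the smallest $n$ such that $X$ has an open cover by $n$ sets each of whose inclusions into $X$ is null-homotopic. For a $G$-space $X$, $\mathrm{cat}_G^{\#}(X)$ is the smallest $n$ such that $X$ has such an open cover consisting of $n$ $G$-invariant sets (null-homotopies need not be equivariant). Both are $\infty$ if no such $n$ exists. *)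

(* Defs.v *)
From HB Require Import structures.
From mathcomp Require Import all_boot all_order all_algebra generic_quotient.
From mathcomp Require Import all_classical all_reals all_analysis.

Set Implicit Arguments.
Unset Strict Implicit.
Unset Printing Implicit Defensive.

Import Order.TTheory GRing.Theory Num.Theory.
Import numFieldNormedType.Exports.

Local Open Scope quotient_scope.
Local Open Scope classical_set_scope.
Local Open Scope ring_scope.

Record involution (T : topologicalType) := Involution {
  invol :> T -> T;
  invol_continuous : continuous invol;
  involK : involutive invol
}.

Section generalized_projective_product.
Context {M N : topologicalType} (tau : involution M) (sigma : involution N).

Definition gpp_rel (p q : M * N) : bool :=
  (p == q) || (p == (tau q.1, sigma q.2)).

Lemma gpp_rel_equiv : equiv_class_of gpp_rel.
Proof.
have swapK : involutive (fun p : M * N => (tau p.1, sigma p.2)).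
  by move=> [x y] /=; rewrite !involK.
split; first by move=> p; rewrite /gpp_rel eqxx.
- move=> p q; rewrite /gpp_rel (eq_sym p q); congr orb.
  by apply/eqP/eqP => ->; rewrite swapK.
- move=> q p r; rewrite /gpp_rel => /orP[/eqP ->//|/eqP ->].
  by move=> /orP[/eqP ->|/eqP ->]; rewrite ?swapK eqxx ?orbT.
Qed.

Canonical gpp_equiv := EquivRelPack gpp_rel_equiv.

(* X(M, N); the quotient makes sense whether or not sigma has fixed points *)
Definition gen_proj_prod : topologicalType :=
  quotient_topology {eq_quot gpp_equiv}.

End generalized_projective_product.

Section sphere.
Variables (R : realType) (n : nat).

(* The topology of 'rV_n.+1 is the product one, so the S^n below is the usual
   one although the library norm on row vectors is the sup norm *)
Definition sphere : set 'rV[R]_n.+1 := [set x | \sum_i x 0 i ^+ 2 = 1].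

Lemma sphereN (x : 'rV[R]_n.+1) : sphere x -> sphere (- x).
Proof.
by rewrite /sphere /= => <-; apply: eq_bigr => i _; rewrite mxE sqrrN.
Qed.

Definition opp_sphere (x : sphere) : sphere :=
  exist _ (- \val x) (mem_set (sphereN (set_mem (valP x)))).

Lemma opp_sphere_continuous : continuous opp_sphere.
Proof.
apply/continuousP => _ [U oU <-]; exists (-%R @^-1` U) => //.
by apply: open_comp oU => x _; exact: opp_continuous.
Qed.

Lemma opp_sphereK : involutive opp_sphere.
Proof. by move=> x; apply/val_inj; rewrite /= opprK. Qed.

Definition antipode : involution sphere :=
  Involution opp_sphere_continuous opp_sphereK.

Lemma antipode_free (x : sphere) : antipode x <> x.
Proof.
move=> /(congr1 val) /= xE; have := set_mem (valP x) : sphere (\val x).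
have x0 i : \val x 0 i = 0.
  by apply/eqP; move/matrixP: xE => /(_ 0 i)/eqP; rewrite mxE eqNr.
rewrite /sphere /= big1 => [/eqP|i _]; last by rewrite x0 expr0n.
by rewrite eq_sym oner_eq0.
Qed.

End sphere.

Definition path_connected (R : realType) (T : topologicalType) :=
  forall x y : T, exists f : R -> T,
    [/\ {within `[0, 1], continuous f}, f 0 = x & f 1 = y].

Definition completely_normal_space (T : topologicalType) :=
  forall A B : set T, separated A B ->
    exists U V : set T,
      [/\ open U, open V, A `<=` U, B `<=` V & U `&` V = set0].

(* the inclusion of U into T is null-homotopic; only the restriction of H to
   U x [0, 1] matters *)
Definition null_homotopic_incl (R : realType) (T : topologicalType)
    (U : set T) :=
  exists (H : T * R -> T) (c : T),
    [/\ {within U `*` `[0, 1], continuous H},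
        forall x, U x -> H (x, 0) = x &
        forall x, U x -> H (x, 1) = c].

Definition categorical_cover (R : realType) (T : topologicalType) (n : nat)
    (U : 'I_n -> set T) :=
  [/\ forall i, open (U i), \bigcup_i U i = [set: T] &
      forall i, null_homotopic_incl R (U i)].

(* An infimum of natural numbers in \bar R is their minimum, or +oo if there
   are none *)
Definition LS_cat (R : realType) (T : topologicalType) : \bar R :=
  ereal_inf [set n%:R%:E | n in
    [set n | exists U : 'I_n -> set T, categorical_cover R U]].

Definition invariant_set (T : Type) (G : set (T -> T)) (U : set T) :=
  forall g, G g -> g @` U = U.

(* The group G acting on T is given by the set of its transformations *)
Definition LS_cat_sharp (R : realType) (T : topologicalType)
    (G : set (T -> T)) : \bar R :=
  ereal_inf [set n%:R%:E | n in
    [set n | exists U : 'I_n -> set T,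
      categorical_cover R U /\ forall i, invariant_set G (U i)]].

(* <tau>: the inverse of tau is tau, so natural powers suffice *)
Definition gen_group (T : topologicalType) (tau : involution T) :
  set (T -> T) := range (fun k => iter k tau).

(* Main.v *)
Require Import Defs.
From mathcomp Require Import all_boot all_order all_algebra generic_quotient.
From mathcomp Require Import all_classical all_reals all_analysis.
From mathcomp Require Import zify lra.

(** The product inequality for the Lusternik-Schnirelmann category, applied to
    two open covers of X = X(M, S^n): one coming from M, one from the affine
    charts of the projective space RP^n.

    Let U_0, ..., U_(m-1) be open tau-invariant subsets of M covering it, each
    null-homotopic in M.  Their saturations give open sets P_j = [tube (U j)] of
    X.  The other cover consists of the n + 1 sets Q_i = [chart i] of classes
    [x, z] with z_i nonzero.  A class in Q_i has exactly one representative with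
    z_i > 0, and this representative depends continuously on the class
    ([chart_lift_continuous]): over Q_i the double cover M x S^n -> X splits.

    Hence P_j `&` Q_i is null-homotopic ([null_homotopic_tube_chart]): lift to
    the representative (x, z) with z_i > 0, move x along the null-homotopy of
    U_j, move z along the segment to the diagonal vector (1, ..., 1) normalized,
    and project back to X.  The null-homotopy of U_j is applied only to the
    chosen representative, so a non-equivariant one still defines a homotopy on
    X; invariance of U_j puts this representative in U_j.  The segment stays in
    z_i > 0 and so avoids the origin.  The diagonal vector works for all i
    simultaneously, and M is path-connected, so all these null-homotopies can be
    made to end at one point.

    There remains to get m + n sets out of the m * (n + 1) sets P_j `&` Q_i
    ([categorical_cover_grid]).  Let P'_j be P_j minus the earlier P's, and
    similarly Q'_i.  The sets P'_j `&` Q'_i cover X, and those on an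
    antidiagonal j + i = k are pairwise separated ([separated_first_in]).
    Complete normality provides disjoint open neighbourhoods
    ([separated_family_nbhs]), and a disjoint union of open sets contracting to
    the same point contracts to that point ([null_homotopic_to_bigcup]).  There
    are m + n antidiagonals. *)

Set Implicit Arguments.
Unset Strict Implicit.
Unset Printing Implicit Defensive.

Import Order.TTheory GRing.Theory Num.Theory.
Import numFieldNormedType.Exports.

Local Open Scope classical_set_scope.
Local Open Scope ring_scope.

(** * Continuity on a subset *)

Lemma cvg_comp_within (S : Type) (T Z : topologicalType) (F : set_system S)
    (FF : Filter F) (B : set T) (g : S -> T) (f : T -> Z) y :
  F (g @^-1` B) -> B y -> g @ F --> y -> {within B, continuous f} ->
  f \o g @ F --> f y.
Proof.
move=> FB By gy /subspace_continuousP /(_ y By) fy A /fy fA.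
have FA := gy _ fA.
by apply: (@filterS2 _ F FF _ _ _ _ FB FA) => x Bx; apply.
Qed.

Section within.
Context {S T Z : topologicalType}.

Lemma within_continuous_comp (A : set S) (B : set T) (g : S -> T)
    (f : T -> Z) :
  {within A, continuous g} -> {homo g : x / A x >-> B x} ->
  {within B, continuous f} -> {within A, continuous (f \o g)}.
Proof.
move=> /subspace_continuousP gc gAB fc; apply/subspace_continuousP => x Ax.
apply: (cvg_comp_within _ _ _ _ fc); [|exact: gAB|exact: gc].
by apply: filterS (withinT A (nbhs_filter x)) => z /gAB.
Qed.

(** Pasting lemma relative to A: C and D are closed in the whole space, so a
    point of A outside one of them has a neighbourhood missing it. *)
Lemma within_continuous_paste (A C D : set S) (f : S -> T) :
  closed C -> closed D -> A `<=` C `|` D ->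
  {within A `&` C, continuous f} -> {within A `&` D, continuous f} ->
  {within A, continuous f}.
Proof.
move=> cC cD ACD fC fD.
suff {C D cC cD ACD fC fD} near_f (E : set S) : closed E ->
    {within A `&` E, continuous f} -> forall x (V : set T), A x ->
    nbhs (f x) V -> \forall y \near x, A y -> E y -> V (f y).
  apply/subspace_continuousP => x Ax V fV.
  have nC := near_f _ cC fC x V Ax fV; have nD := near_f _ cD fD x V Ax fV.
  apply: (@filterS2 _ (nbhs x) _ _ _ _ _ nC nD) => y hC hD Ay.
  by have [Cy|Dy] := ACD _ Ay; [exact: hC | exact: hD].
move=> cE /subspace_continuousP fE x V Ax fV.
have [Ex|nEx] := pselect (E x).
  have : within (A `&` E) (nbhs x) (f @^-1` V) by exact: fE fV.
  by apply: (@filterS _ (nbhs x)) => y h Ay Ey; exact: h.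
have : nbhs x (~` E) by apply: open_nbhs_nbhs; split; [exact: closed_openC|].
by apply: (@filterS _ (nbhs x)) => y nEy _ /nEy.
Qed.

End within.

(** * Sets contracting to a given point *)

Section null_homotopic_to.
Context {R : realType} {T : topologicalType}.

(** The endpoint is a parameter because homotopies on disjoint pieces can be
    glued to a single null-homotopy only when they end at the same point. *)
Definition null_homotopic_to (U : set T) (c : T) :=
  exists H : T * R -> T,
    [/\ {within U `*` `[0, 1], continuous H},
        forall x, U x -> H (x, 0) = x &
        forall x, U x -> H (x, 1) = c].

Lemma null_homotopic_toS (U V : set T) c :
  U `<=` V -> null_homotopic_to V c -> null_homotopic_to U c.
Proof.
move=> UV [H [Hc H0 H1]]; exists H; split=> [|x /UV /H0 //|x /UV /H1 //].
by apply: continuous_subspaceW Hc => -[x t] [/= /UV].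
Qed.

(** Follow the null-homotopy at double speed, then the path. *)
Lemma null_homotopic_to_path (U : set T) c d (f : R -> T) :
  {within `[0, 1], continuous f} -> f 0 = c -> f 1 = d ->
  null_homotopic_to U c -> null_homotopic_to U d.
Proof.
move=> fc f0 f1 [H [Hc H0 H1]].
exists (fun p => if p.2 <= 2^-1 then H (p.1, p.2 * 2) else f (p.2 * 2 - 1)).
split=> [|x Ux|x Ux] /=; last 2 first.
- by rewrite mul0r invr_ge0 ler0n H0.
- rewrite ifN ?mul1r; last by clear; lra.
  by rewrite -f1; congr f; clear; lra.
have c2 : continuous (fun p : T * R => p.2 * 2).
  by move=> p; apply: cvgM; [exact: cvg_snd | exact: cvg_cst].
apply: (@within_continuous_paste (T * R)%type T _ [set p | p.2 <= 2^-1]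
                                  [set p | 2^-1 <= p.2]).
- by apply: (@closed_comp _ _ snd [set t : R | t <= 2^-1]) => [p _|];
    [exact: cvg_snd | exact: closed_le].
- by apply: (@closed_comp _ _ snd [set t : R | 2^-1 <= t]) => [p _|];
    [exact: cvg_snd | exact: closed_ge].
- by move=> p _ /=; case: (leP p.2 2^-1) => [|/ltW]; [left | right].
- pose g (p : T * R) := (p.1, p.2 * 2).
  have gc : {within (U `*` `[0, 1]) `&` [set p | p.2 <= 2^-1], continuous g}.
    apply: continuous_subspaceT => p.
    exact: (cvg_pair (@cvg_fst _ _ (nbhs p.1) (nbhs p.2) _ ) (c2 p)).
  apply: (subspace_eq_continuous _ (within_continuous_comp gc _ Hc)) => /=.
    by move=> p /set_mem [_ /= p2]; rewrite /from_subspace /= p2.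
  move=> p /= [[Up t01] t2]; split => //=.
  by move: t01 t2; rewrite !in_itv /=; clear; lra.
- pose g (p : T * R) := p.2 * 2 - 1.
  have gc : {within (U `*` `[0, 1]) `&` [set p | 2^-1 <= p.2], continuous g}.
    apply: continuous_subspaceT => p.
    by apply: cvgB; [exact: c2 | exact: cvg_cst].
  apply: (subspace_eq_continuous _ (within_continuous_comp gc _ fc)) => /=.
    move=> p /set_mem [[Up _] /= p2]; rewrite /from_subspace /=.
    case: ifPn => // p2'.
    have {p2 p2'} p2E : p.2 = 2^-1 by move: p2 p2'; clear; lra.
    by rewrite /g p2E mulVf ?pnatr_eq0// subrr f0 H1.
  by move=> p /= [[_ +] +]; rewrite /g !in_itv /=; clear; lra.
Qed.

(** Each piece is open and meets no other piece, so near any of its points the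
    glued homotopy agrees with the homotopy of that piece. *)
Lemma null_homotopic_to_bigcup (I : Type) (W : I -> set T) c :
  (forall i, open (W i)) -> trivIset setT W ->
  (forall i, null_homotopic_to (W i) c) ->
  null_homotopic_to (\bigcup_i W i) c.
Proof.
move=> Wo tW /choice [H HP].
pose K (p : T * R) := if pselect (exists i, W i p.1) is left e
  then H (proj1_sig (cid e)) p else c.
have KE i p : W i p.1 -> K p = H i p.
  move=> Wi; rewrite /K; case: pselect => [e|[]]; last by exists i.
  case: cid => j /= Wj; suff -> : i = j by [].
  by apply: tW => //; exists p.1.
exists K; split=> [|x [i _ Wx]|x [i _ Wx]].
- apply/subspace_continuousP => -[x t] [[i _ /= Wx] t01].
  have [Hc _ _] := HP i; move/subspace_continuousP: Hc => /(_ (x, t)) Hc V.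
  rewrite /from_subspace (KE i)//= => /(Hc (conj Wx t01)) HV.
  have : nbhs (x, t) [set p : T * R | W i p.1].
    by apply: cvg_fst; apply: open_nbhs_nbhs.
  move=> Wn; apply: (@filterS2 _ (nbhs (x, t)) _ _ _ _ _ HV Wn) => p h Wp.
  case=> _ p01.
  by rewrite /= (KE i)//; apply: h.
- by rewrite (KE i)//; have [_ ->] := HP i.
- by rewrite (KE i)//; have [_ _ ->] := HP i.
Qed.

End null_homotopic_to.
Arguments null_homotopic_to R {T}.

(** * Separated families *)

Lemma open_disjoint_separated (T : topologicalType) (A B O O' : set T) :
  open O -> open O' -> A `<=` O -> B `<=` O' ->
  A `&` O' = set0 -> B `&` O = set0 -> separated A B.
Proof.
have clI0 (C D P : set T) : open P -> D `<=` P -> C `&` P = set0 ->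
    closure C `&` D = set0.
  move=> oP DP CP; apply/seteqP; split=> // x [Cx Dx].
  have [|y] := Cx P; last by rewrite CP.
  by apply: open_nbhs_nbhs; split=> //; exact: DP.
move=> oO oO' AO BO' AO'0 BO0; split; first exact: clI0 AO'0.
by rewrite setIC; exact: clI0 BO0.
Qed.

(** Complete normality separates two sets at a time; intersecting the finitely
    many neighbourhoods so obtained for each member separates them all. *)
Lemma separated_family_nbhs (T : topologicalType) (I : finType)
    (C : I -> set T) :
  completely_normal_space T ->
  (forall i j, i != j -> separated (C i) (C j)) ->
  exists W : I -> set T,
    [/\ forall i, open (W i), forall i, C i `<=` W i & trivIset setT W].
Proof.
move=> Tcn sepC.
(* Each unordered pair is treated twice, once in each order, which is why W i
   takes both the first component at (i, j) and the second one at (j, i). *)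
have /choice [V VP] : forall q : I * I, exists V : set T * set T,
    q.1 != q.2 -> [/\ open V.1, open V.2, C q.1 `<=` V.1, C q.2 `<=` V.2 &
                      V.1 `&` V.2 = set0].
  move=> [i j] /=; have [->|/sepC/Tcn [A [B ABP]]] := eqVneq i j.
    by exists (set0, set0).
  by exists (A, B).
pose W i := [set x | forall j, j != i -> ((V (i, j)).1 `&` (V (j, i)).2) x].
exists W; split=> [i|i x Cx j ji|i j _ _ [x [Wix Wjx]]].
- rewrite openE => x Wx; apply: filter_forall => j.
  have [ji|_] := boolP (j != i); last by apply: nearW => y.
  have [op1 _ _ _ _] := VP (i, j) (contra_neq esym ji).
  have [_ op2 _ _ _] := VP (j, i) ji.
  have : nbhs x ((V (i, j)).1 `&` (V (j, i)).2).
    by apply: open_nbhs_nbhs; split; [exact: openI | exact: Wx].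
  by apply: filterS.
- have [_ _ C1 _ _] := VP (i, j) (contra_neq esym ji).
  by have [_ _ _ C2 _] := VP (j, i) ji; split; [exact: C1 | exact: C2].
- apply: contrapT => /eqP ij; have [_ _ _ _ V0] := VP (i, j) ij.
  suff : set0 x by []; rewrite -V0; split.
    by have [] := Wix j (contra_neq esym ij).
  by have [] := Wjx i ij.
Qed.

(** * From a grid of contractible sets to a categorical cover *)

Section first_in.
Context {T : Type} {m : nat} (P : 'I_m -> set T).

Definition first_in (j : 'I_m) : set T :=
  P j `\` \bigcup_(j' in [set j' : 'I_m | (j' < j)%N]) P j'.

Lemma bigcup_first_in x : (\bigcup_j P j) x -> exists j, first_in j x.
Proof.
case=> j0 _ /asboolP Pj0.
case: (@arg_minnP _ j0 (fun j => `[< P j x >]) (@nat_of_ord m) Pj0).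
move=> j /asboolP Pj jmin; exists j; split=> // -[j' /= j'j /asboolP /jmin].
by rewrite leqNgt j'j.
Qed.

End first_in.

(** On an antidiagonal the indices move in opposite directions: with j < j' and
    i' < i, the first set lies in P j, which the second one avoids by
    minimality of j', and the second lies in Q i', which the first avoids by
    minimality of i. *)
Lemma separated_first_in (T : topologicalType) (m p : nat)
    (P : 'I_m -> set T) (Q : 'I_p -> set T) (j j' : 'I_m) (i i' : 'I_p) :
  (forall j, open (P j)) -> (forall i, open (Q i)) ->
  (j < j')%N -> (i' < i)%N ->
  separated (first_in P j `&` first_in Q i) (first_in P j' `&` first_in Q i').
Proof.
move=> Po Qo jj' ii'; apply: (open_disjoint_separated (Po j) (Qo i')).
- by move=> x [[]].
- by move=> x [_ []].
- by apply/seteqP; split=> // x [[_ [_ Qlt]] Qx]; apply: Qlt; exists i'.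
- by apply/seteqP; split=> // x [[[_ Plt] _] Px]; apply: Plt; exists j.
Qed.

(** The combinatorial core of the product inequality: m and p + 1 sets have
    m + p antidiagonals, and each antidiagonal yields one set of the cover. *)
Lemma categorical_cover_grid (R : realType) (T : topologicalType) (c : T)
    (m p : nat) (P : 'I_m -> set T) (Q : 'I_p.+1 -> set T) :
  completely_normal_space T ->
  (forall j, open (P j)) -> (forall i, open (Q i)) ->
  \bigcup_j P j = setT -> \bigcup_i Q i = setT ->
  (forall j i, null_homotopic_to R (P j `&` Q i) c) ->
  exists V : 'I_(m + p) -> set T, categorical_cover R V.
Proof.
move=> Tcn Po Qo Pcov Qcov PQc.
pose diag (k : 'I_(m + p)) := {q : 'I_m * 'I_p.+1 | (q.1 + q.2 == k)%N}.
pose C k (q : diag k) := first_in P (val q).1 `&` first_in Q (val q).2.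
have sepC k (q q' : diag k) : q != q' -> separated (C k q) (C k q').
  case: q q' => [[j i] /= kE] [[j' i'] /= kE'] qq'.
  have ji : (j + i = j' + i')%N by rewrite (eqP kE) (eqP kE').
  have [jj'|jj'|jj'] := ltngtP j j'.
  - by apply: separated_first_in => //=; lia.
  - by rewrite separatedC; apply: separated_first_in => //=; lia.
  - case/eqP: qq'; apply/val_inj => /=; congr pair; apply/val_inj => //=; lia.
pose W k := proj1_sig (cid (separated_family_nbhs Tcn (sepC k))).
have WP k := proj2_sig (cid (separated_family_nbhs Tcn (sepC k))).
(* Inside P `&` Q, so that the given null-homotopies apply. *)
pose W' k (q : diag k) := W k q `&` (P (val q).1 `&` Q (val q).2).
have W'o k q : open (W' k q).
  by have [Wo _ _] := WP k; apply: openI; [exact: Wo | exact: openI].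
exists (fun k => \bigcup_q W' k q); split=> [k||k].
- exact: bigcup_open.
- apply/seteqP; split=> // x _.
  have [|j Pj] := @bigcup_first_in _ _ P x; first by rewrite Pcov.
  have [|i Qi] := @bigcup_first_in _ _ Q x; first by rewrite Qcov.
  have kmp : (j + i < m + p)%N by have := ltn_ord j; have := ltn_ord i; lia.
  have qk : ((j, i).1 + (j, i).2 == Ordinal kmp)%N by [].
  exists (Ordinal kmp) => //; exists (exist _ (j, i) qk) => //.
  have [_ CW _] := WP (Ordinal kmp).
  by split; [apply: CW; split | split; [case: Pj | case: Qi]].
- have [H HP] : null_homotopic_to R (\bigcup_q W' k q) c.
    apply: null_homotopic_to_bigcup => // [q q' _ _ [x [[Wx _] [Wx' _]]]|q].
      by have [_ _ tW] := WP k; apply: tW => //; exists x.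
    apply: null_homotopic_toS (PQc (val q).1 (val q).2).
    by move=> x [].
  by exists H, c.
Qed.

(** * Contracting the positive half-spaces of the sphere *)

Section sphere.
Context {R : realType} {n : nat}.
Local Notation S := (@sphere R n).

(** The sphere carries the topology induced by the row vectors. *)
Lemma cvg_sphere (F : set_system S) (z : S) :
  Filter F -> val @ F --> (val z : 'rV[R]_n.+1) -> F --> z.
Proof.
move=> FF Fz A; rewrite /= nbhsE => -[B [[U oU UB] Bz] BA].
apply: (@filterS _ F FF B) => //; rewrite -UB; apply: Fz.
by apply: open_nbhs_nbhs; split=> //; rewrite -UB in Bz.
Qed.

Lemma val_sphere_continuous : continuous (val : S -> 'rV[R]_n.+1).
Proof. by apply/continuousP => U oU; exists U. Qed.

Definition sqnorm (v : 'rV[R]_n.+1) : R := \sum_i v 0 i ^+ 2.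

Lemma sqnorm_sphere (z : S) : sqnorm (val z) = 1.
Proof. exact: (set_mem (valP z)). Qed.

Lemma sqnorm_gt0 (v : 'rV[R]_n.+1) i : v 0 i != 0 -> 0 < sqnorm v.
Proof.
move=> vi; rewrite /sqnorm (bigD1 i) //= ltr_pwDl ?exprn_even_gt0//.
by apply: sumr_ge0 => j _; exact: sqr_ge0.
Qed.

Lemma sqnormZ a v : sqnorm (a *: v) = a ^+ 2 * sqnorm v.
Proof.
by rewrite /sqnorm mulr_sumr; apply: eq_bigr => i _; rewrite mxE exprMn.
Qed.

Lemma sqnorm_continuous : continuous sqnorm.
Proof.
apply: continuous_big => [|i _ v]; first exact: add_continuous.
by apply: (@cvgM _ _ (nbhs v)); exact: coord_continuous.
Qed.

Lemma diagonal_subproof : S (const_mx (Num.sqrt n.+1%:R)^-1).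
Proof.
rewrite /sphere /=; under eq_bigr do rewrite mxE exprVn sqr_sqrtr ?ler0n//.
by rewrite sumr_const card_ord -[_ *+ _]mulr_natl divff// pnatr_eq0.
Qed.

Definition diagonal : S :=
  exist _ (const_mx (Num.sqrt n.+1%:R)^-1) (mem_set diagonal_subproof).

Definition normalize (v : 'rV[R]_n.+1) : S :=
  insubd diagonal ((Num.sqrt (sqnorm v))^-1 *: v).

Lemma val_normalize v :
  0 < sqnorm v -> val (normalize v) = (Num.sqrt (sqnorm v))^-1 *: v.
Proof.
move=> v0; rewrite /normalize insubdK// inE.
rewrite /sphere /= -/(sqnorm _) sqnormZ exprVn sqr_sqrtr ?ltW//.
by rewrite mulVf// gt_eqF.
Qed.

Lemma normalizeK (z : S) : normalize (val z) = z.
Proof.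
apply/val_inj; rewrite val_normalize sqnorm_sphere// sqrtr1 invr1.
by rewrite scale1r.
Qed.

Lemma normalize_continuous v : 0 < sqnorm v -> {for v, continuous normalize}.
Proof.
move=> v0; have FF : Filter (nbhs v) := nbhs_filter v.
apply: cvg_sphere; rewrite val_normalize//.
have near_gt0 : \forall w \near v, 0 < sqnorm w.
  by apply: (cvgr_gt _ (@sqnorm_continuous v)).
have norm_cvg : (Num.sqrt (sqnorm w))^-1 *: w @[w --> v] -->
    (Num.sqrt (sqnorm v))^-1 *: v.
  apply: (@cvgZ _ _ _ (nbhs v)); last exact: cvg_id.
  apply: (@cvgV _ _ (nbhs v)); first by rewrite gt_eqF// sqrtr_gt0.
  apply: (@cvg_comp _ _ _ sqnorm Num.sqrt); first exact: sqnorm_continuous.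
  exact: sqrt_continuous.
apply: cvg_trans norm_cvg; apply: (@near_eq_cvg _ _ (nbhs v) FF).
by apply: (@filterS _ _ FF) near_gt0 => w w0; rewrite /= val_normalize.
Qed.

(** The normalized segment from z to the diagonal vector.  The diagonal vector
    has all its coordinates positive, so this one target serves every set
    z_i > 0, and the i-th coordinate stays positive along the way. *)
Definition push_diagonal (z : S) (t : R) : S :=
  normalize ((1 - t) *: val z + t *: val diagonal).

Lemma push_diagonal0 z : push_diagonal z 0 = z.
Proof. by rewrite /push_diagonal subr0 scale1r scale0r addr0 normalizeK. Qed.

Lemma push_diagonal1 z : push_diagonal z 1 = diagonal.
Proof. by rewrite /push_diagonal subrr scale1r scale0r add0r normalizeK. Qed.

Lemma push_diagonal_cvg (T : Type) (F : set_system T) (FF : Filter F)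
    (f : T -> S) (g : T -> R) (z : S) (t : R) i :
  0 < val z 0 i -> 0 <= t <= 1 -> f @ F --> z -> g @ F --> t ->
  push_diagonal (f x) (g x) @[x --> F] --> push_diagonal z t.
Proof.
move=> zi /andP[t0 t1] fz gt.
pose w (z : S) (t : R) := (1 - t) *: val z + t *: val diagonal.
have w0 : 0 < sqnorm (w z t).
  apply: (@sqnorm_gt0 _ i); rewrite gt_eqF// !mxE.
  have d0 : 0 < (Num.sqrt n.+1%:R)^-1 :> R by rewrite invr_gt0 sqrtr_gt0 ltr0n.
  have [->|tn0] := eqVneq t 0; first by rewrite subr0 mul1r mul0r addr0.
  rewrite ltr_wpDl ?mulr_ge0 ?subr_ge0 ?(ltW zi)// mulr_gt0//.
  by rewrite lt_neqAle eq_sym tn0.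
apply: (@cvg_comp _ _ _ (fun x => w (f x) (g x)) normalize _ (nbhs (w z t)));
  last exact: normalize_continuous.
apply: cvgD; apply: cvgZ => //; last exact: cvg_cst.
  by apply: cvgB => //; exact: cvg_cst.
apply: (@cvg_comp _ _ _ f val _ (nbhs z)) => //.
exact: val_sphere_continuous.
Qed.

End sphere.
Arguments diagonal : clear implicits.

(** * Tubes and charts of the projective product *)

Section gen_proj_prod_sphere.
Local Open Scope quotient_scope.
Context {R : realType} {n : nat} {M : topologicalType} (tau : involution M).
Local Notation S := (@sphere R n).
Local Notation X := (gen_proj_prod tau (antipode R n)).
Local Notation proj := (\pi_X : M * S -> X).

Definition swap (p : M * S) : M * S := (tau p.1, antipode R n p.2).

Lemma swapK : involutive swap.
Proof. by move=> [x z]; congr pair; exact: involK. Qed.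

Lemma swap_continuous : continuous swap.
Proof.
move=> p; apply: (@cvg_pair _ _ _ (nbhs p) (nbhs (tau p.1))
  (nbhs (antipode R n p.2)) _ _ _ (tau \o fst) (antipode R n \o snd)).
  apply: (@cvg_comp _ _ _ fst tau _ (nbhs p.1)); first exact: cvg_fst.
  exact: invol_continuous.
apply: (@cvg_comp _ _ _ snd (antipode R n) _ (nbhs p.2)); first exact: cvg_snd.
exact: invol_continuous.
Qed.

Lemma proj_eqP (p q : M * S) : proj p = proj q <-> p = q \/ p = swap q.
Proof.
split=> [/eqmodP /orP [] /eqP|pq]; [by left|by right|].
by apply/eqmodP/orP; case: pq => ->; rewrite eqxx; [left|right].
Qed.

Lemma proj_surj (q : X) : exists p, proj p = q.
Proof. by exists (repr q); rewrite reprK. Qed.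

(** The saturation of A is the union of A and of its image under the
    involution, hence is open with A. *)
Lemma proj_open (A : set (M * S)) : open A -> open (proj @` A).
Proof.
move=> oA; rewrite /open /= /quotient_open.
suff -> : proj @^-1` (proj @` A) = A `|` swap @^-1` A.
  apply: openU => //.
  by move/continuousP: swap_continuous => /(_ _ oA).
apply/seteqP; split=> [p [q Aq /proj_eqP[<-|qE]]|p [Ap|Ap]].
- by left.
- by right; rewrite /preimage /= -qE.
- by exists p.
- by exists (swap p) => //; apply/proj_eqP; right.
Qed.

(** Since each class has two opposite representatives, this is the set of
    classes whose i-th spherical coordinate is nonzero. *)
Definition chart (i : 'I_n.+1) : set X :=
  proj @` [set p | 0 < (val p.2 : 'rV[R]_n.+1) 0 i].

Definition chart_lift (i : 'I_n.+1) (q : X) : M * S :=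
  let p := repr q in if 0 < (val p.2 : 'rV[R]_n.+1) 0 i then p else swap p.

Lemma open_positive (i : 'I_n.+1) :
  open [set p : M * S | 0 < (val p.2 : 'rV[R]_n.+1) 0 i].
Proof.
have /continuousP : continuous (fun p : M * S => (val p.2 : 'rV[R]_n.+1) 0 i).
  move=> p; apply: (@cvg_comp _ _ _ snd (fun z : S => val z 0 i) _ (nbhs p.2)).
    exact: cvg_snd.
  apply: (@cvg_comp _ _ _ val (fun v : 'rV[R]_n.+1 => v 0 i) _
    (nbhs (val p.2))).
    exact: val_sphere_continuous.
  exact: coord_continuous.
by move=> /(_ _ (@open_gt R 0)).
Qed.

Lemma open_chart i : open (chart i).
Proof. exact/proj_open/open_positive. Qed.

(** A unit vector has a nonzero coordinate, and exchanging the representative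
    makes it positive. *)
Lemma bigcup_chart : \bigcup_i chart i = setT.
Proof.
apply/seteqP; split=> // q _; have [[x z] <-] := proj_surj q.
have [i zi] : exists i, (val z : 'rV[R]_n.+1) 0 i != 0.
  apply: contrapT => z0; have := sqnorm_sphere z.
  rewrite /sqnorm big1 => [/eqP|i _]; first by rewrite eq_sym oner_eq0.
  have [->|zi] := eqVneq ((val z : 'rV[R]_n.+1) 0 i) 0; first by rewrite expr0n.
  by case: z0; exists i.
exists i => //; have [zi0|zi0|/eqP] := ltgtP 0 ((val z : 'rV[R]_n.+1) 0 i).
- by exists (x, z).
- exists (swap (x, z)); first by rewrite /= mxE oppr_gt0.
  by apply/proj_eqP; right.
- by rewrite eq_sym (negbTE zi).
Qed.

Lemma proj_chart_lift i q : proj (chart_lift i q) = q.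
Proof.
rewrite /chart_lift; case: ifP => _; first by rewrite reprK.
by rewrite -[RHS]reprK; apply/proj_eqP; right.
Qed.

Lemma chart_liftK i (p : M * S) :
  0 < (val p.2 : 'rV[R]_n.+1) 0 i -> chart_lift i (proj p) = p.
Proof.
move=> p0; rewrite /chart_lift.
have /proj_eqP[->|->] : proj (repr (proj p)) = proj p by rewrite reprK.
  by rewrite p0.
by rewrite swapK /= mxE oppr_gt0 ltNge (ltW p0).
Qed.

Lemma chart_lift_gt0 i q :
  chart i q -> 0 < (val (chart_lift i q).2 : 'rV[R]_n.+1) 0 i.
Proof. by move=> [p p0 <-]; rewrite chart_liftK. Qed.

(** The projection is open and restricts to an injection on z_i > 0, so its
    inverse there is continuous. *)
Lemma chart_lift_continuous i q :
  chart i q -> {for q, continuous (chart_lift i)}.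
Proof.
move=> iq A; rewrite nbhsE => -[B [oB Bq] BA].
pose C := B `&` [set p : M * S | 0 < (val p.2 : 'rV[R]_n.+1) 0 i].
have : nbhs q (proj @` C).
  apply: open_nbhs_nbhs; split; first by apply/proj_open/openI/open_positive.
  exists (chart_lift i q); last exact: proj_chart_lift.
  by split=> //; exact: chart_lift_gt0.
apply: (@filterS _ (nbhs q)) => _ [p [Bp p0] <-] /=.
by rewrite chart_liftK//; exact: BA.
Qed.

Definition tube (U : set M) : set X := proj @` [set p | U p.1].

Lemma open_tube U : open U -> open (tube U).
Proof.
move=> oU; apply: proj_open.
have /continuousP : continuous (fst : M * S -> M) by move=> p; exact: cvg_fst.
exact.
Qed.

Lemma chart_lift_tube U i q : (forall x, U x -> U (tau x)) ->
  tube U q -> U (chart_lift i q).1.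
Proof.
move=> Utau [p Up qE].
have /proj_eqP[->//|->] : proj (chart_lift i q) = proj p.
  by rewrite proj_chart_lift.
exact: Utau.
Qed.

(** Lift to the positive representative, contract both factors at once, and
    project.  The lift of a class in the tube is in U by invariance of U. *)
Lemma null_homotopic_tube_chart U x0 i : (forall x, U x -> U (tau x)) ->
  null_homotopic_to R U x0 ->
  null_homotopic_to R (tube U `&` chart i) (proj (x0, diagonal R n)).
Proof.
move=> Utau [h [hc h0 h1]].
exists (fun p => let s := chart_lift i p.1 in
  proj (h (s.1, p.2), push_diagonal s.2 p.2)); split=> [|q [Uq iq]|q [Uq iq]].
- apply/subspace_continuousP => -[q t] [[/= Uq iq] t01].
  set F := within _ _; have FF : Filter F by exact: within_filter.
  have s_cvg : chart_lift i p.1 @[p --> F] --> chart_lift i q.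
    apply: (@cvg_comp _ _ _ fst (chart_lift i) F (nbhs q));
      last exact: chart_lift_continuous.
    exact: cvg_comp (cvg_within _) cvg_fst.
  have t_cvg : p.2 @[p --> F] --> t.
    exact: cvg_comp (cvg_within _) cvg_snd.
  have s1 : (chart_lift i p.1).1 @[p --> F] --> (chart_lift i q).1.
    exact: cvg_comp s_cvg cvg_fst.
  have s2 : (chart_lift i p.1).2 @[p --> F] --> (chart_lift i q).2.
    exact: cvg_comp s_cvg cvg_snd.
  apply: (@cvg_comp _ _ _ (fun p => (h ((chart_lift i p.1).1, p.2),
    push_diagonal (chart_lift i p.1).2 p.2)) proj _
    (nbhs (h ((chart_lift i q).1, t), push_diagonal (chart_lift i q).2 t)));
    last exact: pi_continuous.
  apply: (@cvg_pair _ _ _ F (nbhs (h ((chart_lift i q).1, t)))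
    (nbhs (push_diagonal (chart_lift i q).2 t)) _ _ _
    (fun p => h ((chart_lift i p.1).1, p.2))); last first.
    apply: push_diagonal_cvg (chart_lift_gt0 iq) _ s2 t_cvg.
    by move: t01; rewrite in_itv.
  suff : h \o (fun p => ((chart_lift i p.1).1, p.2)) @ F -->
      h ((chart_lift i q).1, t) by exact.
  apply: (cvg_comp_within FF _ _ _ hc) => /=.
  - apply: (@filterS _ F FF _ _ _ (withinT _ _)).
    move=> -[q' t'] [[/= Uq' iq'] t01'].
    by split=> //=; exact: chart_lift_tube.
  - by split=> //=; exact: chart_lift_tube.
  - exact: cvg_pair s1 t_cvg.
- rewrite /= h0; last exact: chart_lift_tube.
  by rewrite push_diagonal0 -surjective_pairing proj_chart_lift.
- by rewrite /= h1 ?push_diagonal1//; exact: chart_lift_tube.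
Qed.

End gen_proj_prod_sphere.

(** * The inequality *)

Lemma LS_cat_empty (R : realType) (T : topologicalType) :
  (T -> False) -> LS_cat R T = 0.
Proof.
move=> T0; apply/eqP; rewrite eq_le; apply/andP; split.
  apply: ereal_inf_lbound; exists 0%N => //; exists (fun=> set0).
  by split=> [[]//||[]//]; apply/seteqP; split=> // x; case: (T0 x).
by apply: le_ereal_inf_tmp => _ [k _ <-]; rewrite lee_fin ler0n.
Qed.

Lemma invariant_gen_group (M : topologicalType) (tau : involution M)
    (U : set M) x :
  invariant_set (gen_group tau) U -> U x -> U (tau x).
Proof.
by move=> Uinv Ux; rewrite -(Uinv tau); [exists x | exists 1%N].
Qed.

Theorem proposition6p3 (R : realType) (n : nat) (n_ge1 : (1 <= n)%N)
    (M : topologicalType) (M_pc : path_connected R M) (tau : involution M)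
    (X_cn : completely_normal_space (gen_proj_prod tau (antipode R n))) :
  (LS_cat R (gen_proj_prod tau (antipode R n)) <=
    LS_cat_sharp R (gen_group tau) + n%:R%:E)%E.
Proof.
rewrite -leeBlDr//; apply: le_ereal_inf_tmp.
move=> _ [m [U [[Uo Ucov Unull] Uinv]] <-]; rewrite leeBlDr//.
(* a contraction needs a target point, so for M empty the m + n sets of the
   general construction are replaced by the empty family *)
have [[x0 _]|M0] := pselect (exists x : M, True); last first.
  rewrite LS_cat_empty; first by rewrite -EFinD lee_fin addr_ge0.
  by move=> q; have [[x _] _] := proj_surj q; apply: M0; exists x.
apply: ereal_inf_lbound; exists (m + n)%N; last by rewrite natrD EFinD.
have Utau j x : U j x -> U j (tau x) by exact: invariant_gen_group.
set X := gen_proj_prod tau (antipode R n) in X_cn *.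
pose c : X := (\pi_X (x0, diagonal R n))%qT.
apply: (@categorical_cover_grid R X c m n (fun j => tube (U j))
                                          (@chart R n M tau)).
- exact: X_cn.
- by move=> j; exact: open_tube.
- exact: open_chart.
- apply/seteqP; split=> // q _; have [[x z] <-] := proj_surj q.
  have : setT x by []; rewrite -Ucov => -[j _ Ujx].
  by exists j => //; exists (x, z).
- exact: bigcup_chart.
- move=> j i; apply: null_homotopic_tube_chart; first exact: Utau.
  have [H [d [Hc H0 H1]]] := Unull j; have [f [fc f0 f1]] := M_pc d x0.
  by apply: (null_homotopic_to_path fc f0 f1); exists H.
Qed.
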